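(* If $G$ is a $2$-connected outerplanar graph with $\Delta(G)=3$ and girth $g(G)\geq 4$, then $\chi_{vi,1}(G)\leq 6$.
   Context: All graphs are finite, simple and undirected. An incidence of $G$ is a pair $(v,e)$ with $v\in V(G)$, $e\in E(G)$, $v\in e$; $I(G)$ is the set of incidences. Let $G^{1/3}$ be obtained from $G$ by replacing each edge $e=\{u,v\}$ by the path $u,(u,e),(v,e),v$. A $vi$-simultaneous proper $k$-coloring of $G$ is a map $c:V(G)\cup I(G)\to\{1,\dots,k\}$ such that any two distinct elements at distance at most $3$ in $G^{1/3}$ receive distinct colors. For a vertex $v$, $I_2(v)=\{(u,\{u,v\}) : u\in N_G(v)\}$. Such a coloring is a $(k,s)$-coloring if for every vertex $v$ at most $s$ distinct colors appear on $I_2(v)$; $\chi_{vi,s}(G)$ is the least such $k$. The girth is the length of a shortest cycle. A graph is outerplanar if it has a planar drawing with all vertices on the outer face. *)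

(* Defs.v *)
From HB Require Import structures.
From mathcomp Require Import all_boot all_order all_algebra.
From mathcomp Require Import all_classical all_reals all_analysis.

Set Implicit Arguments.
Unset Strict Implicit.
Unset Printing Implicit Defensive.

Import Order.TTheory GRing.Theory Num.Theory.
Import numFieldNormedType.Exports.

(* Minimum of a set of naturals; None plays the role of +oo (empty set). *)
Definition least (P : nat -> Prop) : option nat :=
  match pselect (exists n, `[< P n >]) with
  | left exP => Some (ex_minn exP)
  | right _ => None
  end.

Definition least_le (o : option nat) (k : nat) : bool :=
  if o is Some n then n <= k else false.

Definition least_ge (o : option nat) (k : nat) : bool :=
  if o is Some n then k <= n else true.

Record sgraph := SGraph {
  vertex :> finType;
  adj : rel vertex;
  adj_sym : symmetric adj;
  adj_irr : irreflexive adj }.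

Section Graphs.
Variable G : sgraph.

Definition edges : {set {set G}} :=
  [set e : {set G} | [exists u, exists v, adj u v && (e == [set u; v])]]%SET.

Definition neighbors (v : G) : {set G} := [set u | adj v u]%SET.

Definition max_degree : nat := \max_(v : G) #|neighbors v|.

Definition graph_dist (x y : G) : option nat :=
  least (fun n => exists p : seq G,
    [/\ path (@adj G) x p, last x p = y & size p = n]).

Definition is_cycle (c : seq G) : Prop := 2 < size c /\ ucycle (@adj G) c.

Definition girth : option nat :=
  least (fun n => exists c : seq G, is_cycle c /\ size c = n).

Definition avoiding (X : {set G}) : rel G :=
  [rel x y | [&& adj x y, x \notin X & y \notin X]].

Definition k_connected (k : nat) : Prop :=
  k < #|G| /\
  forall X : {set G}, #|X| < k ->
    forall x y : G, x \notin X -> y \notin X -> connect (avoiding X) x y.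

Definition is_incidence (p : G * {set G}) : bool :=
  (p.2 \in edges) && (p.1 \in p.2).

Definition incidence : finType := {p : G * {set G} | is_incidence p}.

(* V(G) together with I(G): also the vertex set of G^{1/3}. *)
Definition vi : finType := (G + incidence)%type.

Definition third_adj (x y : vi) : bool :=
  match x, y with
  | inl _, inl _ => false
  | inl v, inr i | inr i, inl v => (val i).1 == v
  | inr i, inr j => ((val i).2 == (val j).2) && ((val i).1 != (val j).1)
  end.

Lemma third_adj_sym : symmetric third_adj.
Proof.
by case=> [v|i] [w|j] //=; rewrite eq_sym [(val j).1 == _]eq_sym.
Qed.

Lemma third_adj_irr : irreflexive third_adj.
Proof. by case=> [v|i] //=; rewrite !eqxx. Qed.

Definition I2 (v : G) : {set incidence} :=
  [set i : incidence |
    [exists u, (u \in neighbors v) && (val i == (u, [set u; v]))]]%SET.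

End Graphs.

Definition one_third (G : sgraph) : sgraph :=
  SGraph (@third_adj_sym G) (@third_adj_irr G).

Definition vi_proper (G : sgraph) (k : nat) (c : vi G -> 'I_k) : Prop :=
  forall x y : one_third G,
    x != y -> least_le (graph_dist x y) 3 -> c x != c y.

Definition ks_coloring (G : sgraph) (k s : nat) (c : vi G -> 'I_k) : Prop :=
  vi_proper c /\
  forall v : G, #|[set c (inr i) | i in I2 v]%SET| <= s.

Definition chi_vi (s : nat) (G : sgraph) : option nat :=
  least (fun k => exists c : vi G -> 'I_k, ks_coloring s c).

Local Open Scope classical_set_scope.
Local Open Scope ring_scope.

Section Drawings.
Variables (R : realType) (G : sgraph).

(* [edge_arc e], restricted to [0, 1], is a simple arc joining the two ends of the
   edge [e]; its values for [e \notin edges G] are irrelevant. *)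
Record drawing := Drawing {
  pos : G -> R * R;
  edge_arc : {set G} -> R -> R * R;
  pos_inj : injective pos;
  arc_cont : forall e, e \in edges G ->
    {within `[0, 1], continuous (edge_arc e)};
  arc_inj : forall e, e \in edges G ->
    {in `[0, 1] &, injective (edge_arc e)};
  arc_ends : forall e, e \in edges G ->
    [set edge_arc e 0; edge_arc e 1] = pos @` [set` e];
  arc_vertex : forall e v (t : R), e \in edges G ->
    t \in `]0, 1[ -> edge_arc e t <> pos v;
  arc_disjoint : forall e f (t u : R),
    e \in edges G -> f \in edges G -> e != f ->
    t \in `]0, 1[ -> u \in `]0, 1[ -> edge_arc e t <> edge_arc f u }.

Definition drawn (D : drawing) : set (R * R) :=
  range (pos D) `|` \bigcup_(e in [set` edges G]) (edge_arc D e @` `[0, 1]).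

Definition is_face (D : drawing) (F : set (R * R)) : Prop :=
  exists2 z, (~` drawn D) z & F = connected_component (~` drawn D) z.

Definition outer_face (D : drawing) (F : set (R * R)) : Prop :=
  is_face D F /\ ~ bounded_set F.

Definition outerplanar : Prop :=
  exists D : drawing, exists2 F : set (R * R),
    outer_face D F & forall v : G, closure F (pos D v).

End Drawings.

(* Main.v *)
(** In a colouring with one colour on each [I2 v], let [b v] be that colour and
    [f v] the colour of [v]. Properness then says that [b] is proper on the
    square of [G], [f] is proper on [G], and [f v] avoids [b] on the closed
    neighbourhood of [v].

    Such a colouring is grown along ears. The coloured vertices X always span a
    cycle of [G] (at first an edge, counted as a 2-cycle). Since [G] is
    2-connected, X has an ear while it is not everything; let P be a shortest
    one, with ends a and c. If both arcs of the cycle between a and c had inner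
    vertices, then P and these arcs would be three internally disjoint a-c
    paths of length at least 2, so a and c are consecutive on the cycle. Then P
    has at least two inner vertices because [G] has no triangle, P is induced
    because it is shortest, and a and c have at most one other neighbour in X
    because degrees are at most 3. Six colours suffice to colour P greedily.

    An outerplanar graph has no three such paths: joining a point of the outer
    face to one inner vertex of each would draw K_{3,3} with independent edges
    disjoint. That is impossible even if the edges are just compact connected
    sets: replace each by a fine chain of its points, each chain by an
    axis-parallel staircase, and count modulo 2 the crossings of independent
    staircases. There are none, yet the number depends only on the end points
    and is odd. *)
Require Import Defs.
From Stdlib Require Import Btauto.
From mathcomp Require Import all_boot all_order all_algebra lra zify.
From mathcomp Require Import all_classical all_reals all_analysis.

Set Implicit Arguments.
Unset Strict Implicit.
Unset Printing Implicit Defensive.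

Import Order.TTheory GRing.Theory Num.Theory.
Import numFieldNormedType.Exports.

(** * Crossing parities of staircases *)

Section Chains.
Variable R : realType.
Local Open Scope ring_scope.
Implicit Types (p q r s x y : R * R) (d : R).

Definition xlex p q := (p.1 < q.1) || (p.1 == q.1) && (p.2 < q.2).
Definition ylex p q := (p.2 < q.2) || (p.2 == q.2) && (p.1 < q.1).
Definition within_box d p q := (`|p.1 - q.1| < d) && (`|p.2 - q.2| < d).

Lemma xlex_flip p q : p != q -> xlex q p = ~~ xlex p q.
Proof.
case: p q => [p1 p2] [q1 q2]; rewrite /xlex /= xpair_eqE.
by case: (ltgtP p1 q1) => //= _; case: ltgtP.
Qed.

Lemma ylex_flip p q : p != q -> ylex q p = ~~ ylex p q.
Proof.
case: p q => [p1 p2] [q1 q2]; rewrite /ylex /= xpair_eqE andbC.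
by case: (ltgtP p2 q2) => //= _; case: ltgtP.
Qed.

Lemma within_boxC d p q : within_box d p q = within_box d q p.
Proof. by rewrite /within_box distrC [X in _ && (X < _)]distrC. Qed.

Lemma within_boxxx d p : 0 < d -> within_box d p p.
Proof. by move=> d0; rewrite /within_box !subrr normr0 d0. Qed.

Lemma far_neq d p q : 0 < d -> ~~ within_box d p q -> p != q.
Proof. by move=> d0; apply: contraNneq => <-; apply: within_boxxx. Qed.

Lemma xlex_between d p q s :
  xlex p s != xlex q s -> within_box d p q -> `|p.1 - s.1| < d.
Proof.
case: p q s => [p1 p2] [q1 q2] [s1 s2]; rewrite /xlex /within_box /=.
move=> H /andP[+ _]; rewrite !ltr_norml => /andP[H1 H2].
case: (ltgtP p1 s1) H => [A|A|->] /=; rewrite ?subrr;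
  case: (ltgtP q1 s1) => [B|B|B] //= _; apply/andP; split; lra.
Qed.

Lemma ylex_between d p q s :
  ylex p s != ylex q s -> within_box d p q -> `|p.2 - s.2| < d.
Proof.
case: p q s => [p1 p2] [q1 q2] [s1 s2]; rewrite /ylex /within_box /=.
move=> H /andP[_]; rewrite !ltr_norml => /andP[H1 H2].
case: (ltgtP p2 s2) H => [A|A|->] /=; rewrite ?subrr;
  case: (ltgtP q2 s2) => [B|B|B] //= _; apply/andP; split; lra.
Qed.

(* The staircase from [p] to [q] runs horizontally, then vertically; the
   horizontal part of this one misses the vertical part of the one from [r]
   to [s]. The lexicographic orders make all coordinates distinct. *)
Lemma far_no_crossing d p q r s :
  within_box d p q -> within_box d r s -> ~~ within_box d p s ->
  xorb (xlex p s) (xlex q s) && xorb (ylex r p) (ylex s p) = false.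
Proof.
move=> pq rs; apply: contraNF => /andP[A B]; apply/andP; split.
  by apply: xlex_between pq; move: A; case: (xlex p s); case: (xlex q s).
rewrite distrC; rewrite within_boxC in rs; apply: ylex_between rs.
by move: B; case: (ylex r p); case: (ylex s p).
Qed.

(* Parity of the crossings of the staircase through [r :: f] with the
   horizontal ray to the right of [x]. *)
Fixpoint escape x r (f : seq (R * R)) : bool :=
  if f is s :: f' then
    xorb (xlex x s && xorb (ylex x r) (ylex x s)) (escape x s f')
  else false.

(** The number modulo 2 of crossings of the staircases through [p :: e] and [r :: f], when no point
    lies on both chains. Every term sees at least one of the two chains through its ends only, so
    the sum is additive when either chain is cut at one of its points: the terms at the cut occur
    twice. *)
Definition end_parity p e r f : bool :=
  xorb (xorb (xorb (escape p r f) (escape (last p e) r f))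
             (xorb (escape r p e) (escape (last r f) p e)))
       (xorb (xorb (ylex p r) (ylex p (last r f)))
             (xorb (ylex (last p e) r) (ylex (last p e) (last r f)))).

(** For single steps the order flips turn [end_parity] into the sum of the two possible crossings,
    each of a horizontal part with the vertical part of the other staircase. Both vanish by
    [far_no_crossing]. *)
Lemma end_parity_cell d p q r s : 0 < d -> within_box d p q -> within_box d r s ->
  {in [:: p; q] & [:: r; s], forall x y, ~~ within_box d x y} ->
  end_parity p [:: q] r [:: s] = false.
Proof.
move=> d0 pq rs far.
have far' x y : x \in [:: p; q] -> y \in [:: r; s] -> x != y.
  by move=> xe yf; apply: far_neq (far _ _ xe yf).
have [ps qr] : ~~ within_box d p s /\ ~~ within_box d r q.
  by split; [|rewrite within_boxC]; apply: far; rewrite !inE eqxx ?orbT.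
have := far_no_crossing pq rs ps; have := far_no_crossing rs pq qr.
have -> := @xlex_flip q r (far' _ _ _ _); rewrite ?inE ?eqxx ?orbT //.
have -> := @xlex_flip q s (far' _ _ _ _); rewrite ?inE ?eqxx ?orbT //.
have pr : p != r by apply: far'; rewrite !inE eqxx ?orbT.
have ps' : p != s by apply: far'; rewrite !inE eqxx ?orbT.
have qr' : q != r by apply: far'; rewrite !inE eqxx ?orbT.
have qs' : q != s by apply: far'; rewrite !inE eqxx ?orbT.
rewrite /end_parity /= (ylex_flip pr) (ylex_flip ps') (xlex_flip qr').
rewrite (xlex_flip qs') (ylex_flip qr') (ylex_flip qs').
by case: (xlex p s); case: (xlex q r); case: (xlex q s);
  case: (ylex p r); case: (ylex p s); case: (ylex q r); case: (ylex q s).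
Qed.

Lemma end_parity_step d p q r f : 0 < d ->
  within_box d p q -> path (within_box d) r f ->
  {in [:: p; q] & r :: f, forall x y, ~~ within_box d x y} ->
  end_parity p [:: q] r f = false.
Proof.
move=> d0 pq; elim: f r => [|s f IH] r /=.
  by rewrite /end_parity /=; move=> *; btauto.
move=> /andP[rs sf] far.
have H1 : end_parity p [:: q] r [:: s] = false.
  apply: end_parity_cell d0 pq rs _ => x y xp yr; apply: far xp _.
  by move: yr; rewrite !inE => /orP[]->; rewrite ?orbT.
have H2 : end_parity p [:: q] s f = false.
  by apply: IH sf _ => x y xp yr; apply: far xp _; rewrite inE yr orbT.
rewrite -[RHS](f_equal2 xorb H1 H2) /end_parity /=; btauto.
Qed.

Lemma end_parity_far d p e r f : 0 < d ->
  path (within_box d) p e -> path (within_box d) r f ->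
  {in p :: e & r :: f, forall x y, ~~ within_box d x y} ->
  end_parity p e r f = false.
Proof.
move=> d0 + rf; elim: e p => [|q e IH] p /=.
  by rewrite /end_parity /=; move=> *; btauto.
move=> /andP[pq qe] far.
have H1 : end_parity p [:: q] r f = false.
  apply: end_parity_step d0 pq rf _ => x y xp yr; apply: far yr.
  by move: xp; rewrite !inE => /orP[]->; rewrite ?orbT.
have H2 : end_parity q e r f = false.
  by apply: IH qe _ => x y xp yr; apply: far yr; rewrite inE xp orbT.
rewrite -[RHS](f_equal2 xorb H1 H2) /end_parity /=; btauto.
Qed.

(* Summing [end_parity] over the 18 pairs of independent edges, every
   [escape] term occurs twice, and the remaining terms cancel but for
   [ylex (y j) (y l)] and [ylex (y l) (y j)], whose sum 1 occurs 9 times. *)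
Lemma K33_no_chains d (x y : 'I_3 -> R * R) (e : 'I_3 -> 'I_3 -> seq (R * R)) :
  0 < d ->
  (forall i j, path (within_box d) (x i) (e i j) /\ last (x i) (e i j) = y j) ->
  (forall i j k l, i != k -> j != l ->
     {in x i :: e i j & x k :: e k l, forall p q, ~~ within_box d p q}) ->
  False.
Proof.
move=> d0 chain far.
have H i j k l : i != k -> j != l ->
    end_parity (x i) (e i j) (x k) (e k l) = false.
  move=> ik jl; apply: end_parity_far d0 _ _ (far _ _ _ _ ik jl);
  by have [] := chain i j; have [] := chain k l.
have yl j l : j != l -> ylex (y l) (y j) = ~~ ylex (y j) (y l).
  move=> jl; apply/ylex_flip/(far_neq d0).
  have [_ <-] := chain ord0 j; have [_ <-] := chain ord_max l.
  by apply: (far ord0 j ord_max l) => //; apply: mem_last.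
have E i j : last (x i) (e i j) = y j by have [] := chain i j.
pose o0 : 'I_3 := @Ordinal 3 0 isT; pose o1 : 'I_3 := @Ordinal 3 1 isT.
pose o2 : 'I_3 := @Ordinal 3 2 isT.
have K i k : i != k -> [/\
   end_parity (x i) (e i o0) (x k) (e k o1) = false,
   end_parity (x i) (e i o0) (x k) (e k o2) = false,
   end_parity (x i) (e i o1) (x k) (e k o0) = false &
   [/\ end_parity (x i) (e i o1) (x k) (e k o2) = false,
   end_parity (x i) (e i o2) (x k) (e k o0) = false &
   end_parity (x i) (e i o2) (x k) (e k o1) = false]].
  by move=> ik; split; [| | |split]; apply: H.
have := K o0 o1 isT; have := K o0 o2 isT; have := K o1 o2 isT.
rewrite /end_parity !E (yl o0 o1) // (yl o0 o2) // (yl o1 o2) //.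
move: (ylex (y o0) (y o1)) (ylex (y o0) (y o2)) (ylex (y o1) (y o2)) => b01 b02 b12.
move=> [a1 a2 a3 [a4 a5 a6]] [b1 b2 b3 [b4 b5 b6]] [c1 c2 c3 [c4 c5 c6]].
have sum6 b1' b2' b3' b4' b5' b6' : b1' = false -> b2' = false ->
    b3' = false -> b4' = false -> b5' = false -> b6' = false ->
    xorb (xorb b1' b2') (xorb (xorb b3' b4') (xorb b5' b6')) = false.
  by move=> -> -> -> -> -> ->.
have := f_equal2 xorb (sum6 _ _ _ _ _ _ a1 a2 a3 a4 a5 a6)
  (f_equal2 xorb (sum6 _ _ _ _ _ _ b1 b2 b3 b4 b5 b6)
                 (sum6 _ _ _ _ _ _ c1 c2 c3 c4 c5 c6)).
apply/Bool.not_false_iff_true; clear; btauto.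
Qed.

End Chains.

(** * Connected and compact sets in the plane *)

Section Plane.
Variable R : realType.
Local Open Scope classical_set_scope.
Local Open Scope ring_scope.
Implicit Types (p q x y : R * R) (A B C K U : set (R * R)).

Lemma within_box_ball d p q : within_box d p q <-> ball p d q.
Proof. by split => [/andP[]|[]] *; [split|apply/andP; split]. Qed.

(** A symmetric transitive relation that holds between each point of [A] and its neighbours in [A]
    has relatively open classes. The class of [p] and its complement are then both relatively open,
    so connectedness leaves one class. *)
Lemma connected_equiv A (E : R * R -> R * R -> Prop) p q : connected A ->
  (forall x y z, E x y -> E y z -> E x z) ->
  (forall x y, E x y -> E y x) ->
  (forall x, A x -> \forall y \near x, A y -> E x y) ->
  A p -> A q -> E p q.
Proof.
move=> cA tr sy loc Ap Aq.
(* The points near which every [y] in [A] satisfies [P (E p y)]; [P] will be the identity for the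
   class of [p] and negation for its complement. *)
pose O P := [set x | exists2 V, open V & V x /\ forall y, V y -> A y -> P (E p y)].
have opn P : open (O P).
  rewrite openE => x [V oV [Vx H]]; rewrite /interior.
  by apply: filterS (open_nbhs_nbhs (conj oV Vx)) => y Vy; exists V.
have EO x : A x -> E p x -> O id x.
  move=> Ax px; have := loc x Ax; rewrite /prop_near1 nbhsE => -[V [oV Vx] H].
  by exists V => //; split=> // y Vy Ay; apply: tr px (H _ Vy Ay).
have EO' x : A x -> ~ E p x -> O not x.
  move=> Ax px; have := loc x Ax; rewrite /prop_near1 nbhsE => -[V [oV Vx] H].
  by exists V => //; split=> // y Vy Ay py; apply: px; apply: tr py (sy _ _ (H _ Vy Ay)).
suff : A `&` O id = A.
  by move=> /seteqP[_ /(_ _ Aq)] [_ [V _ [Vq /(_ _ Vq Aq)]]].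
apply: cA.
- by exists p; split=> //; apply: EO => //; apply: (nbhs_singleton (loc p Ap)).
- by exists (O id).
- exists (~` O not); first exact: open_closedC.
  apply/seteqP; split => x [Ax H]; split=> //.
    by case: H => V _ [Vx /(_ _ Vx Ax)] px [W _ [Wx /(_ _ Wx Ax)]].
  by apply: EO => //; apply: contrapT => /(EO' _ Ax).
Qed.

Lemma connected_chain A d p q : connected A -> 0 < d -> A p -> A q ->
  exists s, [/\ path (within_box d) p s, last p s = q &
                {in p :: s, forall x, A x}].
Proof.
move=> cA d0 Ap Aq.
pose E x y := exists s, [/\ path (within_box d) x s, last x s = y &
                           {in x :: s, forall x, A x}].
apply: (@connected_equiv A E) => // {p q Ap Aq}.
- move=> x y z [s [ps ls As]] [t [pt lt At]]; exists (s ++ t); split.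
  + by rewrite cat_path ps ls.
  + by rewrite last_cat ls.
  + move=> w; rewrite -cat_cons mem_cat => /orP[/As //|wt].
    by apply: At; rewrite inE wt orbT.
- move=> x y [s [ps ls As]]; exists (rev (belast x s)); split.
  + rewrite -ls rev_path; apply: sub_path ps => a b /=.
    by rewrite within_boxC.
  + by case: s {ps As} ls => //= z s _; rewrite rev_cons last_rcons.
  + by move=> w wt; apply: As; rewrite lastI ls -mem_rev rev_rcons.
- move=> x Ax; apply/nbhs_ballP; exists d => //= y /within_box_ball xy Ay.
  exists [:: y]; split=> //=; first by rewrite xy.
  by move=> z; rewrite !inE => /orP[] /eqP ->.
Qed.

(** Compactness is demanded because it keeps disjoint edges a positive distance apart; a face need
    not provide it by itself. *)
Definition joined U p q :=
  exists2 K, compact K /\ connected K & [/\ K `<=` U, K p & K q].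

Lemma joined_trans U x y z : joined U x y -> joined U y z -> joined U x z.
Proof.
move=> [K [cK nK] [KU Kx Ky]] [L [cL nL] [LU Ly Lz]].
exists (K `|` L); first by split; [exact: compactU|apply: connectedU => //; exists y].
by split; [rewrite subUset|left|right].
Qed.

Lemma joined_sym U x y : joined U x y -> joined U y x.
Proof. by move=> [K cK [KU Kx Ky]]; exists K. Qed.

Lemma joined_ball d x y : ball x d y -> joined (ball x d) x y.
Proof.
move=> xy; pose f (t : R) : R * R := x + t *: (y - x).
have cf : continuous f.
  by move=> t; apply: cvgD; [exact: cvg_cst|apply: cvgZr_tmp; exact: cvg_id].
exists (f @` `[0, 1]).
  split.
    by apply: continuous_compact; [exact: continuous_subspaceT|exact: segment_compact].
  by apply: connected_continuous_connected; [exact: segment_connected|exact: continuous_subspaceT].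
have bnd (a b t : R) : 0 <= t <= 1 -> `|a - b| < d -> `|a - (a + t * (b - a))| < d.
  move=> /andP[t0 t1] ab.
  rewrite (_ : a - _ = t * (a - b)); last by lra.
  by rewrite normrM (ger0_norm t0); apply: le_lt_trans ab; rewrite ler_piMl.
split.
- move=> _ /= [t +] <-; rewrite in_itv /= => t01.
  by case: xy => x1 x2; split; apply: bnd.
- exists 0; first by rewrite /= in_itv /= lexx ler01.
  by rewrite /f scale0r addr0.
- exists 1; first by rewrite /= in_itv /= lexx ler01.
  by rewrite /f scale1r subrKC.
Qed.

Lemma joined_sub U V x y : U `<=` V -> joined U x y -> joined V x y.
Proof. by move=> UV [K cK [KU Kx Ky]]; exists K => //; split=> // z /KU/UV. Qed.

(** Around each point of [A] a ball lies in [U], and segments join its points to the centre, so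
    [joined U] is a relation to which [connected_equiv] applies. *)
Lemma connected_joined A U p q : connected A -> open U -> A `<=` U ->
  A p -> A q -> joined U p q.
Proof.
move=> cA oU AU; apply: connected_equiv => //.
- exact: joined_trans.
- exact: joined_sym.
move=> x /AU Ux; have : nbhs x U by apply: open_nbhs_nbhs.
move=> /nbhs_ballP[d d0 dU]; apply/nbhs_ballP; exists d => //= y xy _.
exact: joined_sub dU (joined_ball xy).
Qed.

Lemma compact_far A B : compact A -> compact B -> A `&` B = set0 ->
  \forall d \near 0^'+, forall x y, A x -> B y -> ~~ within_box d x y.
Proof.
move=> cA cB AB.
have clB : closed B by apply: compact_closed cB; exact: norm_hausdorff.
(* In this form compactness of [A] makes uniform a [d] found locally. Locally half the radius of a
   ball missing [B] works, the other half being spent on moving [x]. *)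
have : \forall d \near 0^'+, A `<=` (fun x => forall y, B y -> ~~ within_box d x y).
  move/compact_near_coveringP : cA; apply => x Ax.
  have : nbhs x (~` B).
    apply: open_nbhs_nbhs; split; first exact: closed_openC.
    by move=> Bx; have : (A `&` B) x by []; rewrite AB.
  move=> /nbhs_ballP[e e0 eB].
  have e20 : 0 < e / 2 by rewrite divr_gt0.
  near=> x' d => y By; apply/negP => /within_box_ball x'y.
  apply: (eB y) => //; apply: (@ball_split _ _ x'); first by near: x'; exact: nbhsx_ballx.
  suff de : d <= e / 2 by apply: le_ball x'y.
  by near: d; exact: nbhs_right_le.
by apply: filterS => d H x y Ax; apply: H.
Unshelve. all: by end_near. Qed.

End Plane.

(** * No drawing of K_{3,3} by continua *)

Section K33.
Variable R : realType.
Local Open Scope classical_set_scope.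
Local Open Scope ring_scope.

Lemma K33_no_continua (x y : 'I_3 -> R * R) (E : 'I_3 -> 'I_3 -> set (R * R)) :
  (forall i j, [/\ compact (E i j), connected (E i j), E i j (x i) & E i j (y j)]) ->
  (forall i j k l, i != k -> j != l -> E i j `&` E k l = set0) ->
  False.
Proof.
move=> cE dE.
pose far d (t : 'I_3 * 'I_3 * 'I_3 * 'I_3) :=
  let: (i, j, k, l) := t in i != k -> j != l ->
  forall p q, E i j p -> E k l q -> ~~ within_box d p q.
have nearfar t : \forall d \near (0 : R)^'+, far d t.
  case: t => [[[i j] k] l]; rewrite /far.
  case: (eqVneq i k) => [_|ik]; first exact: nearW.
  case: (eqVneq j l) => [_|jl]; first exact: nearW.
  have [cij _ _ _] := cE i j; have [ckl _ _ _] := cE k l.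
  by apply: filterS (compact_far cij ckl (dE _ _ _ _ ik jl)) => d H _ _.
(* The index quadruples are finite in number, so a single [d] separates all pairs of independent
   edges. *)
have [d [d0 Hfar]] : exists d : R, 0 < d /\ forall t, far d t.
  apply: (@filter_ex _ (0 : R)^'+); apply: filterI; first exact: nbhs_right_gt.
  exact: (filter_forall _ nearfar).
have chain (ij : 'I_3 * 'I_3) : exists s, [/\ path (within_box d) (x ij.1) s,
    last (x ij.1) s = y ij.2 & {in x ij.1 :: s, forall p, E ij.1 ij.2 p}].
  by have [_ c xE yE] := cE ij.1 ij.2; apply: connected_chain.
have [e He] := choice chain.
apply: (@K33_no_chains R d x y (fun i j => e (i, j))) => //.
  by move=> i j; have [] := He (i, j).
move=> i j k l ik jl p q pe qe.
have [_ _ Hi] := He (i, j); have [_ _ Hk] := He (k, l).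
exact: (Hfar (i, j, k, l)) ik jl _ _ (Hi _ pe) (Hk _ qe).
Qed.

End K33.

(** * Paths of the graph as sets in a drawing *)

Section Drawing.
Variables (R : realType) (G : sgraph) (D : drawing R G).
Local Open Scope classical_set_scope.
Local Open Scope ring_scope.

Definition arc (u v : G) : set (R * R) := edge_arc D [set u; v]%SET @` `[0, 1].

Fixpoint trace (u : G) (s : seq G) : set (R * R) :=
  if s is v :: s' then arc u v `|` trace v s' else [set pos D u].

Lemma adj_edge u v : adj u v -> [set u; v]%SET \in edges G.
Proof.
move=> uv; rewrite inE; apply/existsP; exists u; apply/existsP; exists v.
by rewrite uv eqxx.
Qed.

Lemma arc_compact u v : adj u v -> compact (arc u v).
Proof.
move=> /adj_edge/(@arc_cont _ _ D) c; apply: continuous_compact => //.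
exact: segment_compact.
Qed.

Lemma arc_connected u v : adj u v -> connected (arc u v).
Proof.
move=> /adj_edge/(@arc_cont _ _ D) c; apply: connected_continuous_connected => //.
exact: segment_connected.
Qed.

Lemma arc_pos u v w : adj u v -> w \in [set u; v]%SET -> arc u v (pos D w).
Proof.
move=> /adj_edge/(@arc_ends _ _ D) e wuv.
have : (pos D @` [set` [set u; v]%SET]) (pos D w) by exists w.
rewrite -e => -[] ->; [exists 0|exists 1] => //=;
  by rewrite in_itv /= lexx ler01.
Qed.

Lemma arcP u v z : adj u v -> arc u v z ->
  (exists2 w, w \in [set u; v]%SET & z = pos D w) \/
  (exists2 t, t \in `]0, 1[ & z = edge_arc D [set u; v]%SET t).
Proof.
move=> /adj_edge/(@arc_ends _ _ D) e [t /= + <-]; rewrite in_itv /= => /andP[t0 t1].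
have ends s : s = 0 \/ s = 1 -> exists2 w, w \in [set u; v]%SET &
    edge_arc D [set u; v]%SET s = pos D w.
  move=> s01; suff : (pos D @` [set` [set u; v]%SET]) (edge_arc D [set u; v]%SET s).
    by case=> w wuv <-; exists w.
  by rewrite -e; case: s01 => ->; [left|right].
case: (eqVneq t 0) => [->|tn0]; first by left; apply: ends; left.
case: (eqVneq t 1) => [->|tn1]; first by left; apply: ends; right.
by right; exists t => //; rewrite in_itv /= !lt_neqAle eq_sym tn0 t0 tn1 t1.
Qed.

Lemma arc_drawn u v : adj u v -> arc u v `<=` drawn D.
Proof. by move=> /adj_edge e z uvz; right; exists [set u; v]%SET. Qed.

Lemma trace_pos u s : path (@adj G) u s -> {in u :: s, forall w, trace u s (pos D w)}.
Proof.
elim: s u => [|v s IH] u /=; first by move=> _ w; rewrite inE => /eqP ->.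
move=> /andP[uv vs] w; rewrite inE => /orP[/eqP->|ws].
  by left; apply: arc_pos; rewrite // !inE eqxx.
by right; apply: IH.
Qed.

Lemma trace_compact u s : path (@adj G) u s -> compact (trace u s).
Proof.
elim: s u => [|v s IH] u /=; first by move=> _; exact: compact_set1.
by move=> /andP[uv vs]; apply: compactU; [exact: arc_compact|exact: IH].
Qed.

Lemma trace_connected u s : path (@adj G) u s -> connected (trace u s).
Proof.
elim: s u => [|v s IH] u /=; first by move=> _; exact: connected1.
move=> /andP[uv vs]; apply: connectedU; [|exact: arc_connected|exact: IH].
exists (pos D v); split; first by apply: arc_pos; rewrite // !inE eqxx orbT.
by apply: trace_pos; rewrite // mem_head.
Qed.

Lemma trace_drawn u s : path (@adj G) u s -> trace u s `<=` drawn D.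
Proof.
elim: s u => [|v s IH] u /=; first by move=> _ _ ->; left; exists u.
by move=> /andP[uv vs]; rewrite subUset; split; [exact: arc_drawn|exact: IH].
Qed.

Lemma traceP u s z : path (@adj G) u s -> trace u s z ->
  (exists2 w, w \in u :: s & z = pos D w) \/
  (exists a b, [/\ a \in u :: s, b \in u :: s, adj a b &
    exists2 t, t \in `]0, 1[ & z = edge_arc D [set a; b]%SET t]).
Proof.
elim: s u => [|v s IH] u /=; first by move=> _ ->; left; exists u; rewrite ?mem_head.
move=> /andP[uv vs] [/(arcP uv)[[w wuv ->]|Ht]|/(IH _ vs)[[w ws ->]|[a [b [as' bs ab H]]]]].
- left; exists w => //; move: wuv; rewrite !inE => /orP[]->; rewrite ?orbT //.
- by right; exists u, v; rewrite !inE !eqxx ?orbT.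
- by left; exists w; rewrite // inE ws orbT.
- by right; exists a, b; rewrite inE as' inE bs !orbT.
Qed.

(** A point of a trace is a vertex or interior to an edge. Of the four combinations, two vertices
    are excluded by [pos_inj], the mixed ones by [arc_vertex], and two edges by [arc_disjoint], as
    edges with no common end are distinct. *)
Lemma trace_disjoint u s v t : path (@adj G) u s -> path (@adj G) v t ->
  ~~ has (mem (u :: s)) (v :: t) -> trace u s `&` trace v t = set0.
Proof.
move=> us vt /hasPn dis; apply/seteqP; split=> // z [].
have neq w w' : w \in u :: s -> w' \in v :: t -> w != w'.
  by move=> ws /dis; apply: contraNneq => <-.
move=> /(traceP us)[[w ws ->]|[a [b [aus bus ab [r r01 ->]]]]].
  move=> /(traceP vt)[[w' wt /(@pos_inj _ _ D) E]|[a [b [av bv ab [r r01 /esym]]]]].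
    by have := neq _ _ ws wt; rewrite E eqxx.
  by apply: arc_vertex r01; apply: adj_edge.
move=> /(traceP vt)[[w wt]|[c [d [cv dv cd [r' r'01]]]]].
  by apply: arc_vertex r01; apply: adj_edge.
apply: arc_disjoint => //; try exact: adj_edge.
apply/eqP => /setP/(_ a); rewrite !inE eqxx /= => /esym/orP[] /eqP E.
  by have := neq _ _ aus cv; rewrite E eqxx.
by have := neq _ _ aus dv; rewrite E eqxx.
Qed.

Lemma trace_notin u s w : path (@adj G) u s -> w \notin u :: s -> ~ trace u s (pos D w).
Proof.
move=> us ws uw; have := @trace_disjoint u s w [::] us isT.
rewrite /= orbF => /(_ ws)/seteqP[/(_ (pos D w)) H _]; exact: H.
Qed.

(** Some ball around [pos D w] misses the compact set [W] and contains a point [q] of the face. Go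
    from [z] to [q] near the face, within the open complement of [W], then straight to [pos D w]
    within the ball. *)
Lemma face_leg z w (W : set (R * R)) :
  closure (connected_component (~` drawn D) z) (pos D w) -> (~` drawn D) z ->
  compact W -> W `<=` drawn D -> ~ W (pos D w) ->
  joined (~` W) z (pos D w).
Proof.
move=> clF Fz cW WD Ww.
have oW : open (~` W).
  by apply: closed_openC; apply: compact_closed cW; exact: norm_hausdorff.
have : nbhs (pos D w) (~` W) by apply: open_nbhs_nbhs.
move=> /nbhs_ballP[e e0 eW].
have [q [Fq wq]] := clF _ (nbhsx_ballx (pos D w) e e0).
apply: (@joined_trans _ _ _ q); last first.
  by apply: joined_sym; apply: joined_sub eW _; apply: joined_ball.
apply: connected_joined oW _ _ Fq; first exact: component_connected.
  by move=> p /connected_component_sub pD /WD.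
exact: connected_component_refl.
Qed.

End Drawing.

(** * Outerplanar graphs contain no theta with three long paths *)

Section NoTheta.
Variables (R : realType) (G : sgraph).
Hypothesis outer : outerplanar R G.
Local Open Scope classical_set_scope.

(** The sides of the K_{3,3} are [a], [c], [z] and the first inner vertices [y i] of the paths. Each
    path is cut at [y i] into the edges to [a] and [c]; legs from the outer face supply the edges to
    [z]. *)
Lemma outerplanar_no_theta (a c : G) (P : 'I_3 -> seq G) :
  a != c ->
  (forall i, P i != [::]) ->
  (forall i, path (@adj G) a (rcons (P i) c)) ->
  (forall i, (a \notin P i) && (c \notin P i)) ->
  (forall i j, i != j -> ~~ has (mem (P i)) (P j)) ->
  False.
Proof.
move=> ac P0 pP acP disP.
have [D [F [[z Dz ->] _] clF]] := outer.
pose y i := head a (P i).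
pose Q i := rcons (behead (P i)) c.
have PE i : P i = y i :: behead (P i) by have := P0 i; rewrite /y; case: (P i).
have yP i : y i \in P i by rewrite PE mem_head.
have pa i : path (@adj G) a [:: y i].
  by have := pP i; rewrite PE /= => /andP[-> _].
have pc i : path (@adj G) (y i) (Q i).
  by have := pP i; rewrite PE /= => /andP[_].
have Qmem i w : w \in y i :: Q i -> w \in P i \/ w = c.
  by rewrite /Q -rcons_cons -PE mem_rcons inE => /orP[/eqP->|]; [right|left].
pose W i := trace D a [:: y i] `|` trace D (y i) (Q i).
have Wdis i j : i != j -> ~ W i (pos D (y j)).
  move=> ij; have yj : y j \notin P i.
    by apply/negP => yji; have /hasPn/(_ _ (yP j)) := disP _ _ ij; rewrite /= yji.
  have [/andP[aPj cPj]] := acP j.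
  case; apply: trace_notin => //; last first.
    apply/negP => /Qmem[]; first by apply/negP.
    by move=> yc; rewrite -yc yP in cPj.
  rewrite !inE negb_or; apply/andP; split.
    by apply: contraNneq aPj => <-.
  by apply: contraNneq yj => ->.
have cW i : compact (W i) by apply: compactU; exact: trace_compact.
have WD i : W i `<=` drawn D by rewrite subUset; split; exact: trace_drawn.
(* A leg only has to miss the other two paths: it shares an end of the K_{3,3} with the other legs
   and with both edges of its own path. *)
have leg i : exists K, [/\ compact K, connected K, K z, K (pos D (y i)) &
    forall j, j != i -> K `&` W j = set0].
  have : joined (~` \bigcup_(j in [set` [pred j | j != i]]) W j) z (pos D (y i)).
    apply: face_leg => //.
    - by rewrite bigcup_pred; exact: bigsetU_compact.
    - by move=> p [j _ /WD].
    - by move=> [j /= ji]; apply: Wdis.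
  move=> [K [cK nK] [KW Kz Ky]]; exists K; split=> // j ji.
  by apply/seteqP; split=> // p [/KW Kp Wp]; apply: Kp; exists j.
have [K HK] := choice leg.
pose x (i : 'I_3) := match val i with 0 => pos D a | 1 => pos D c | _ => z end.
pose E (i j : 'I_3) := match val i with
  0 => trace D a [:: y j] | 1 => trace D (y j) (Q j) | _ => K j end.
have dac j l : j != l -> trace D a [:: y j] `&` trace D (y l) (Q l) = set0.
  move=> jl; apply: trace_disjoint => //; apply/hasPn => w /Qmem H.
  have [/andP[aPl cPl] /andP[aPj cPj]] := (acP l, acP j).
  rewrite /= !inE negb_or; case: H => [wl|->].
    apply/andP; split; first by apply: contraNneq aPl => <-.
    have /hasPn/(_ _ wl) := disP _ _ jl; apply: contraNneq => ->; exact: yP.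
  by rewrite eq_sym ac /=; apply: contraNneq cPj => ->; exact: yP.
have dK j l (T : set (R * R)) : j != l -> T `<=` W j -> K l `&` T = set0.
  have [_ _ _ _ H] := HK l; move=> /H + TW; rewrite -!subset0 => KW p [Kp /TW Wp].
  exact: KW.
apply: (@K33_no_continua R x (fun j => pos D (y j)) E).
  move=> i j; rewrite /E /x; case: i => -[|[|[|//]]] /= _; last by have [] := HK j.
  - split; [exact (@trace_compact _ _ D _ _ (pa j))|exact (@trace_connected _ _ D _ _ (pa j))| |];
      by apply: (@trace_pos _ _ D _ _ (pa j)); rewrite !inE eqxx ?orbT.
  - split; [exact: trace_compact|exact: trace_connected| |];
      by apply: trace_pos; rewrite // ?mem_head // /Q inE mem_rcons mem_head orbT.
move=> i j k l; rewrite /E.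
have [W1 W2] : (forall j, trace D a [:: y j] `<=` W j) /\
    forall j, trace D (y j) (Q j) `<=` W j.
  by split=> ? p; [left|right].
case: i => -[|[|[|//]]] /= ?; case: k => -[|[|[|//]]] /= ? // _ jl.
- exact: dac.
- by rewrite setIC; apply: dK jl _; exact: W1.
- by rewrite setIC; apply: dac; rewrite eq_sym.
- by rewrite setIC; apply: dK jl _; exact: W2.
- by apply: dK; [rewrite eq_sym; exact: jl|exact: W1].
- by apply: dK; [rewrite eq_sym; exact: jl|exact: W2].
Qed.

End NoTheta.

(** * Colouring a path between precoloured ends *)

Section PathColouring.

Lemma ord_avoid n (s : seq 'I_n) : size s < n -> exists x, x \notin s.
Proof.
move=> sn; apply/existsP; rewrite -negb_forall; apply/negP => /forallP sT.
have := card_size s; rewrite (eq_card (B := 'I_n)); last exact: sT.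
by rewrite card_ord leqNgt sn.
Qed.

(* [b i] is the common colour of the incidences pointing at the [i]-th vertex
   of a path with [m] inner vertices, and [c i] the colour of that vertex. *)
Definition path_colouring m (b c : nat -> 'I_6) : Prop :=
  [/\ forall i, i <= m.+1 -> c i != b i,
      forall i, i <= m -> [&& b i != b i.+1, c i != c i.+1,
                            c i != b i.+1 & b i != c i.+1] &
      forall i, i < m -> b i != b i.+2].

Lemma path_colouring_cons m b c b0 c0 :
  path_colouring m b c -> c0 != b0 ->
  [&& b0 != b 0, c0 != c 0, c0 != b 0 & b0 != c 0] -> b0 != b 1 ->
  path_colouring m.+1 (fun i => if i is j.+1 then b j else b0)
                      (fun i => if i is j.+1 then c j else c0).
Proof. by move=> [H1 H2 H3] c0b0 H01 H02; split=> -[|i] //=; auto. Qed.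

(** Here [q], [r] and [q'], [r'] are the colours at the two ends, [p] and [p'] those of incidences
    pointing at vertices just beyond them, and [x] is a spare prohibition. Colouring the first inner
    vertex reduces [m]; with two inner vertices left, no choice has more than five prohibitions. *)
Lemma extend_path m p q r p' q' r' x : q != r -> q' != r' ->
  exists b c, [/\ path_colouring m.+2 b c, b 0 = q /\ c 0 = r,
    b m.+3 = q' /\ c m.+3 = r', b 1 != p & b m.+2 \notin [:: p'; x]].
Proof.
move=> + qr'; elim: m p q r => [|m IH] p q r qr.
  have [b2] := @ord_avoid 6 [:: q; p'; q'; r'; x] isT.
  have [b1] := @ord_avoid 6 [:: p; q; r; q'; b2] isT.
  have [c1] := @ord_avoid 6 [:: q; b1; b2; r] isT.
  have [c2] := @ord_avoid 6 [:: b1; b2; q'; r'; c1] isT.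
  rewrite !inE !negb_or => /and5P[? ? ? ? ?] /and4P[? ? ? ?].
  move=> /and5P[? ? ? ? ?] /and5P[? ? ? ? ?].
  pose B i := nth q [:: q; b1; b2; q'] i; pose C i := nth r [:: r; c1; c2; r'] i.
  exists B, C; rewrite /B /C /=; split=> //; last by rewrite !inE negb_or; apply/andP.
  by split=> -[|[|[|[|i]]]] //= _; rewrite ?andbT; try (apply/and4P; split); rewrite // eq_sym.
have [b1] := @ord_avoid 6 [:: p; q; r] isT.
have [c1] := @ord_avoid 6 [:: q; b1; r] isT.
rewrite !inE !negb_or => /and3P[c1q c1b1 c1r] /and3P[b1p b1q b1r].
have [|b [c [ok [b0 c0] [bm cm] b1q' bl]]] := IH q b1 c1; first by rewrite eq_sym.
exists (fun i => if i is j.+1 then b j else q), (fun i => if i is j.+1 then c j else r).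
split=> //; last by rewrite b0.
apply: path_colouring_cons ok _ _ _; rewrite ?b0 ?c0; [by rewrite eq_sym| |by rewrite eq_sym].
by rewrite ![q == _]eq_sym ![r == _]eq_sym b1q b1r c1q c1r.
Qed.

(** The ends of the ear will be adjacent, so each end's neighbour on the ear is also at distance two
    from the opposite end: hence the prohibitions [q'] and [q]. *)
Lemma extend_ear m p q r p' q' r' : q != r -> q' != r' ->
  exists b c, [/\ path_colouring m.+2 b c, b 0 = q /\ c 0 = r,
    b m.+3 = q' /\ c m.+3 = r', b 1 \notin [:: p; q'] &
    b m.+2 \notin [:: p'; q]].
Proof.
case: m => [|m] qr qr'.
  (* With just two inner vertices, [b 1 != q'] is the distance-two condition [b 1 != b 3] of the
     path. *)
  have [b [c [ok e0 [e1 e1'] b1 bl]]] := extend_path 0 p p' q qr qr'.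
  exists b, c; split=> //; rewrite !inE negb_or b1 /= -e1.
  by case: ok => _ _; apply.
have [b1] := @ord_avoid 6 [:: p; q; r; q'] isT.
have [c1] := @ord_avoid 6 [:: q; b1; r] isT.
rewrite !inE !negb_or => /and3P[c1q c1b1 c1r] /and4P[b1p b1q b1r b1q'].
have [|b [c [ok [b0 c0] [bm cm] b1q'' bl]]] := @extend_path m q b1 c1 p' q' r' q _ qr'.
  by rewrite eq_sym.
exists (fun i => if i is j.+1 then b j else q), (fun i => if i is j.+1 then c j else r).
split=> //; last by rewrite !inE negb_or b0 b1p.
apply: path_colouring_cons ok _ _ _; rewrite ?b0 ?c0; [by rewrite eq_sym| |by rewrite eq_sym].
by rewrite ![q == _]eq_sym ![r == _]eq_sym b1q b1r c1q c1r.
Qed.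

End PathColouring.

(** * Ears and their minimality *)

Lemma path_first_hit (T : eqType) (e : rel T) (X : {pred T}) x p :
  path e x p -> x \notin X -> last x p \in X ->
  exists q y, [/\ path e x (rcons q y), y \in X & all [predC X] q].
Proof.
elim: p x => [|y p IH] x /=; first by move=> _ /negP.
move=> /andP[xy yp] xX lX; case: (boolP (y \in X)) => yX.
  by exists [::], y; rewrite /= xy.
have [q [z [qz zX qX]]] := IH _ yp yX lX.
by exists (y :: q), z; rewrite /= xy qz yX qX.
Qed.

Section Ears.
Variable G : sgraph.
Implicit Types (X : {set G}) (a c u v w : G) (P : seq G).

Local Notation adjp := (path (@adj G)).

(** [P] lists the inner vertices and may repeat them; minimality will rule repetitions out. *)
Definition ear X a P c : bool :=
  [&& [&& a \in X, c \in X & a != c], P != [::], all [predC X] P & adjp a (rcons P c)].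

Definition shortest_ear X a P c : Prop :=
  ear X a P c /\ forall a' P' c', ear X a' P' c' -> size P <= size P'.

(** Walk from outside into [X], first meeting it at [a], and let [w] be the vertex just before. With
    [a] deleted, [w] still reaches [X], first at some [c] other than [a]. *)
Lemma ear_exists X : k_connected G 2 -> 1 < #|X| -> X != [set: G]%SET ->
  exists a P c, ear X a P c.
Proof.
move=> [_ conn] X2 XT.
have [v vX] : exists v, v \notin X.
  apply/existsP; rewrite -negb_forall; apply: contra XT => /forallP XT.
  by apply/eqP/setP => v; rewrite inE XT.
have avoid_adj Z : subrel (avoiding Z) (@adj G) by move=> x y /and3P[].
have [x0 x0X] : exists x, x \in X by apply/card_gt0P/ltnW.
have /connectP[p pp lp] : connect (avoiding finset.set0) v x0.
  by apply: conn; rewrite ?cards0 ?inE.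
have [q [a [qa aX qX]]] : exists q y, [/\ path (avoiding finset.set0) v (rcons q y),
    y \in mem X & all [predC mem X] q].
  by apply: path_first_hit pp vX _; rewrite -lp.
set w := last v q; have wX : w \notin X.
  rewrite /w; case/lastP: q {qa w} qX => // q w.
  by rewrite all_rcons last_rcons => /andP[].
have wa : adj w a by move: qa; rewrite rcons_path => /andP[_ /avoid_adj].
have [x1 x1X x1a] : exists2 x, x \in X & x != a.
  have : 0 < #|(X :\ a)%SET| by move: X2; rewrite (cardsD1 a) aX.
  by move=> /card_gt0P[x]; rewrite !inE => /andP[xa xX]; exists x.
have /connectP[p' pp' lp'] : connect (avoiding [set a]%SET) w x1.
  by apply: conn; rewrite ?cards1 ?inE //; apply: contraNneq wX => ->.
have [q' [c [qc cX q'X]]] : exists q y, [/\ path (avoiding [set a]%SET) w (rcons q y),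
    y \in mem X & all [predC mem X] q].
  by apply: path_first_hit pp' wX _; rewrite -lp'.
have ca : c != a.
  by move: qc; rewrite rcons_path => /andP[_ /and3P[_ _]]; rewrite inE.
exists a, (w :: q'), c; rewrite /ear aX cX eq_sym ca /= wX q'X adj_sym wa.
exact: sub_path (@avoid_adj _) _ _ qc.
Qed.

Lemma shortest_ear_exists X : k_connected G 2 -> 1 < #|X| -> X != [set: G]%SET ->
  exists a P c, shortest_ear X a P c.
Proof.
move=> conn X2 XT; have [a0 [P0 [c0 e0]]] := ear_exists conn X2 XT.
pose S n := `[< exists a P c, ear X a P c /\ size P = n >].
have exS : exists n, S n by exists (size P0); apply/asboolP; exists a0, P0, c0.
have [n /asboolP[a [P [c [e <-]]]] mn] := ex_minnP exS.
exists a, P, c; split=> // a' P' c' e'; apply: mn.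
by apply/asboolP; exists a', P', c'.
Qed.

Section ShortestEar.
Variables (X : {set G}) (a c : G) (P : seq G).
Hypothesis short : shortest_ear X a P c.

Let eP : ear X a P c. Proof. by case: short. Qed.
Let minP a' P' c' : ear X a' P' c' -> size P <= size P'.
Proof. by case: short => _; apply. Qed.

Lemma shortest_ear_chord P1 p Q q P3 : P = P1 ++ p :: Q ++ q :: P3 ->
  adj p q -> Q = [::].
Proof.
move=> E pq; move: eP; rewrite /ear E => /and4P[/and3P[aX cX ac] _].
rewrite all_cat /= all_cat /= => /and5P[P1X pX _ qX P3X].
rewrite rcons_cat cat_path /= rcons_cat cat_path /= => /and5P[aP1 lp _ _ qP3].
have /minP : ear X a (P1 ++ p :: q :: P3) c.
  rewrite /ear aX cX ac all_cat /= P1X pX qX P3X rcons_cat cat_path /= aP1 lp pq qP3.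
  by case: (P1).
rewrite E !size_cat /= size_cat /= leq_add2l !ltnS addnS ltnS -{2}[size P3]add0n.
by rewrite leq_add2r leqn0 size_eq0 => /eqP.
Qed.

Lemma shortest_ear_uniq : uniq P.
Proof.
apply/negPn/negP => /(uniqPn a)[i [j [ij jP E]]].
have iP : i < size P by apply: ltn_trans jP.
move: eP; rewrite /ear => /and4P[/and3P[aX cX ac] _ PX pP].
have /minP : ear X a (take i P ++ drop j P) c.
  rewrite /ear aX cX ac /=; apply/and3P; split.
  - by rewrite -size_eq0 size_cat size_drop -lt0n; lia.
  - apply/allP => x; rewrite mem_cat => /orP[/mem_take|/mem_drop];
    by move/allP: PX; apply.
  - have [p1 p2] := (pP, pP).
    rewrite -[P](cat_take_drop i) in p1; rewrite -[P](cat_take_drop j) in p2.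
    move: p1 p2; rewrite !rcons_cat !cat_path (drop_nth a iP) (drop_nth a jP) /= E.
    by move=> /and3P[-> -> _] /and3P[].
by rewrite size_cat size_take size_drop iP; lia.
Qed.

(** If [x] is not [a], leaving the ear at [p] for [x] gives an ear from [a], so by minimality [p] is
    last in [P]; symmetrically [p] is first if [x] is not [c]. Both at once would leave only one
    inner vertex. *)
Lemma shortest_ear_attach P1 p P2 x : 1 < size P -> P = P1 ++ p :: P2 ->
  x \in X -> adj p x -> x = a /\ P1 = [::] \/ x = c /\ P2 = [::].
Proof.
move=> P2' E xX px; move: eP; rewrite /ear E => /and4P[/and3P[aX cX ac] _].
rewrite all_cat /= => /and3P[P1X pX P2X].
rewrite rcons_cat cat_path /= => /and3P[aP1 lp pP2].
have xa : x != a -> P2 = [::].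
  move=> xa; have /minP : ear X a (rcons P1 p) x.
    rewrite /ear aX xX eq_sym xa all_rcons /= pX P1X !rcons_path aP1 lp last_rcons px.
    by case: (P1).
  rewrite E size_cat size_rcons /= addnS ltnS -{2}[size P1]addn0.
  by rewrite leq_add2l leqn0 size_eq0 => /eqP.
have xc : x != c -> P1 = [::].
  move=> xc; have /minP : ear X x (p :: P2) c.
    by rewrite /ear xX cX xc /= pX P2X adj_sym px.
  rewrite E size_cat /= -{2}[(size P2).+1]add0n.
  by rewrite leq_add2r leqn0 size_eq0 => /eqP.
have [xa'|xa'] := eqVneq x a; first by left; split=> //; apply: xc; rewrite xa'.
have [xc'|xc'] := eqVneq x c; first by right; split=> //; apply: xa.
by move: P2'; rewrite E xa // xc.
Qed.

(** In [a :: P] index [i] is the predecessor of the inner vertex [nth c P i]; past the end of [P]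
    the default [c] of [nth] is the successor of the last one. *)
Lemma shortest_ear_neighbor i y : 1 < size P -> i < size P ->
  (y \in X) || (y \in P) -> adj (nth c P i) y ->
  y = nth c (a :: P) i \/ y = nth c P i.+1.
Proof.
move=> P2 iP yXP; set p := nth c P i => py.
have E : P = take i P ++ p :: drop i.+1 P by rewrite -drop_nth // cat_take_drop.
have si : size (take i P) = i by rewrite size_take iP.
case: (boolP (y \in X)) yXP => [yX _|_ /= yP].
  have [[-> E1]|[-> E2]] := shortest_ear_attach P2 E yX py.
    by left; move: si; rewrite E1 => /= <-.
  right; rewrite nth_default //.
  by move/(congr1 size): E2; rewrite size_drop /= => ?; lia.
have := yP; rewrite -index_mem; set j := index y P => jP.
have yE : y = nth c P j by rewrite nth_index.
have [ij|ji|ij] := ltngtP i j.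
- right; rewrite yE; congr nth.
  have E' : drop i.+1 P = take (j - i.+1) (drop i.+1 P) ++ y :: drop j.+1 P.
    by rewrite yE -drop_nth // -{1}(cat_take_drop (j - i.+1) (drop i.+1 P)) drop_drop subnK.
  have : take (j - i.+1) (drop i.+1 P) = [::].
    by apply: (@shortest_ear_chord (take i P) p _ y (drop j.+1 P)); rewrite // -E'.
  move/(congr1 size); rewrite size_takel /=; last by rewrite size_drop leq_sub2r // ltnW.
  by move=> /eqP; rewrite subn_eq0 => ji; apply/eqP; rewrite eqn_leq ji.
- left; rewrite yE.
  have E' : drop j.+1 P = take (i - j.+1) (drop j.+1 P) ++ p :: drop i.+1 P.
    by rewrite -drop_nth // -{1}(cat_take_drop (i - j.+1) (drop j.+1 P)) drop_drop subnK.
  have : take (i - j.+1) (drop j.+1 P) = [::].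
    apply: (@shortest_ear_chord (take j P) y _ p (drop i.+1 P)); last by rewrite adj_sym.
    by rewrite -E' yE -drop_nth // cat_take_drop.
  move/(congr1 size); rewrite size_takel /=; last by rewrite size_drop leq_sub2r // ltnW.
  move=> /eqP; rewrite subn_eq0 => ij; suff -> : i = j.+1 by [].
  by apply/eqP; rewrite eqn_leq ij.
- by move: py; rewrite /p ij -yE adj_irr.
Qed.

End ShortestEar.
End Ears.

(** * Extending a colouring along an ear *)

Section ColourExtension.
Variable G : sgraph.
Implicit Types (X : {set G}) (a c u v w : G) (P : seq G).

(* [b v] is the common colour of [I2 v], so the incidence [(u, uv)] has colour
   [b v]; [f v] is the colour of the vertex [v]. *)
Definition colouring X (b f : G -> 'I_6) : Prop :=
  [/\ {in X, forall v, f v != b v},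
      {in X &, forall v w, adj v w ->
        [&& b v != b w, f v != f w, f v != b w & b v != f w]} &
      {in X & &, forall u v w, adj u v -> adj v w -> u != w -> b u != b w}].

Lemma colour_edge a c : exists b f, adj a c -> colouring [set a; c]%SET b f.
Proof.
pose n (i : nat) : 'I_6 := inord i.
exists (fun v => if v == a then n 0 else n 1), (fun v => if v == a then n 2 else n 3) => ac.
have nE i j : i < 6 -> j < 6 -> (n i == n j) = (i == j).
  by move=> ? ?; rewrite -val_eqE /= !inordK.
have ca : (c == a) = false by apply/eqP => ca; rewrite ca adj_irr in ac.
split.
- by move=> v _; case: ifP => _; rewrite nE.
- move=> v w; rewrite !inE => /orP[] /eqP -> /orP[] /eqP ->; rewrite ?eqxx ?ca ?nE ?adj_irr //.
- move=> u v w; rewrite !inE => /orP[] /eqP -> /orP[] /eqP -> /orP[] /eqP ->;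
  by rewrite ?adj_irr ?eqxx // ?ca ?nE.
Qed.

(** Of the at most three neighbours of [a], two are [c] and the outside vertex [u], so at most one
    other lies in [X]. *)
Lemma other_neighbor_colour X a c u (b : G -> 'I_6) : max_degree G = 3 ->
  c \in X -> adj a c -> u \notin X -> adj a u ->
  exists k, {in X, forall w, adj a w -> w != c -> b w = k}.
Proof.
move=> deg cX ac uX au.
case: (pickP [pred w in X | adj a w && (w != c)]) => [w /and3P[wX aw wc]|none]; last first.
  by exists ord0 => w wX aw wc; have := none w; rewrite /= wX aw wc.
exists (b w) => v vX av vc; have [->//|vw] := eqVneq v w.
have : #|neighbors a| <= 3 by rewrite -deg; apply: leq_bigmax.
have sub : {subset [:: u; c; w; v] <= neighbors a}.
  by move=> x; rewrite !inE => /or4P[] /eqP ->.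
have un : uniq [:: u; c; w; v].
  have un x : x \in X -> u != x by move=> xX; apply: contraNneq uX => ->.
  by rewrite /= !inE !negb_or !un //= [c == w]eq_sym wc [c == v]eq_sym vc [w == v]eq_sym vw.
rewrite leqNgt => /negP[]; rewrite cardE; apply: (uniq_leq_size un) => x /sub.
by rewrite mem_enum.
Qed.

Lemma colour_ear X a c P b f : max_degree G = 3 ->
  shortest_ear X a P c -> 1 < size P -> adj a c -> colouring X b f ->
  exists b' f', colouring (X :|: [set v in P])%SET b' f'.
Proof.
move=> deg sh P2 ac [col1 col2 col3].
have Pu := shortest_ear_uniq sh.
have nbr := shortest_ear_neighbor sh P2.
have /and4P[/and3P[aX cX anc] P0 PX pP] := proj1 sh.
have notX v : v \in P -> v \notin X by move=> vP; move/allP: PX => /(_ _ vP).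
have aP : a \notin P by apply: contraL aX => /notX.
have cP : c \notin P by apply: contraL cX => /notX.
(* The ear with its ends: [s 0] is [a], [s i.+1] the inner vertex of index [i], and [s (size P).+1]
   is [c] by default. *)
pose s := nth c (a :: P).
have sS i : s i.+1 = nth c P i by [].
have sP i : i < size P -> s i.+1 \in P by move=> iP; apply: mem_nth.
have sc : s (size P).+1 = c by rewrite sS nth_default.
have adj_s i : i <= size P -> adj (s i) (s i.+1).
  move=> iP; move/(pathP c): pP => /(_ i); rewrite size_rcons ltnS => /(_ iP).
  rewrite -rcons_cons !nth_rcons /= ltnS iP; case: ltngtP iP => // -> _.
  by rewrite sc.
have [ka Ha] : exists k, {in X, forall w, adj a w -> w != c -> b w = k}.
  apply: (@other_neighbor_colour X a c (s 1)) => //; first by apply: notX; apply: sP; apply: ltnW.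
  exact: (adj_s 0).
have [kc Hc] : exists k, {in X, forall w, adj c w -> w != a -> b w = k}.
  apply: (@other_neighbor_colour X c a (s (size P))) => //; rewrite 1?adj_sym //.
    by apply: notX; case: (size P) P2 (sP (size P).-1) => //= n _; apply.
  by rewrite -[X in adj _ X]sc; apply: adj_s.
have [m sm] : exists m, size P = m.+2 by case: (size P) P2 => [|[|m]] // _; exists m.
have [na nc] : b a != f a /\ b c != f c by rewrite ![b _ == _]eq_sym !col1.
have [B [F [[ok1 ok2 ok3] [B0 F0] [Bm Fm] B1 Bl]]] := extend_ear m ka kc na nc.
rewrite -sm in ok1 ok2 ok3 Bm Fm Bl.
pose ext (h : G -> 'I_6) (H : nat -> 'I_6) v := if v \in P then H (index v P).+1 else h v.
have extE h H i : H 0 = h a -> H (size P).+1 = h c -> i <= (size P).+1 -> ext h H (s i) = H i.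
  move=> H0 Hc'; case: i => [_|i]; first by rewrite /ext /s /= (negbTE aP).
  rewrite ltnS leq_eqVlt => /orP[/eqP ->|iP]; first by rewrite sc /ext (negbTE cP).
  by rewrite /ext sP // sS index_uniq.
have bE i : i <= (size P).+1 -> ext b B (s i) = B i by apply: extE.
have fE i : i <= (size P).+1 -> ext f F (s i) = F i by apply: extE.
have extX h H v : v \notin P -> ext h H v = h v by rewrite /ext => /negbTE ->.
have inP v : v \in P -> exists2 i, i < size P & v = s i.+1.
  by move=> vP; exists (index v P); rewrite ?index_mem // sS nth_index.
have nbr' v w : v \in P -> w \in (X :|: [set v in P])%SET -> adj v w ->
    exists2 i, i < size P & v = s i.+1 /\ (w = s i \/ w = s i.+2).
  move=> /inP[i iP ->] wXP vw; exists i => //; split=> //.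
  by apply: nbr => //; move: wXP; rewrite !inE.
have nbr_a u : u \in P -> adj a u -> u = s 1.
  move=> uP au; have [||i iP [-> [E|E]]] := nbr' u a uP; rewrite ?inE ?aX // 1?adj_sym //.
    by case: i iP E => // i iP E; have := sP i (ltnW iP); rewrite -E (negbTE aP).
  have [iP'|iP'] := ltnP i.+1 (size P); first by have := sP _ iP'; rewrite -E (negbTE aP).
  by move: anc; rewrite E sS nth_default ?eqxx.
have nbr_c u : u \in P -> adj c u -> u = s (size P).
  move=> uP cu; have [||i iP [-> [E|E]]] := nbr' u c uP; rewrite ?inE ?cX // 1?adj_sym //.
    case: i iP E => [_ E|i iP E]; first by move: anc; rewrite E eqxx.
    by have := sP i (ltnW iP); rewrite -E (negbTE cP).
  have [iP'|iP'] := ltnP i.+1 (size P); first by have := sP _ iP'; rewrite -E (negbTE cP).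
  by congr s; apply/eqP; rewrite eqn_leq iP.
have inX v : v \in (X :|: [set v in P])%SET -> v \notin P -> v \in X.
  by rewrite !inE => /orP[//|->].
exists (ext b B), (ext f F); split.
- move=> v vX'; have [/inP[i iP ->]|vP] := boolP (v \in P).
    by rewrite bE ?fE ?ok1 // !ltnS ltnW.
  by rewrite !extX // col1 // inX.
- have key v w : v \in P -> w \in (X :|: [set v in P])%SET -> adj v w ->
      [&& ext b B v != ext b B w, ext f F v != ext f F w,
          ext f F v != ext b B w & ext b B v != ext f F w].
    move=> vP wX' vw; have [i iP [-> [->|->]]] := nbr' v w vP wX' vw.
      have := ok2 i (ltnW iP); rewrite !bE ?fE ?ltnS 1?ltnW // 1?ltnW // => /and4P[h1 h2 h3 h4].
      by apply/and4P; split; rewrite eq_sym.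
    by have := ok2 i.+1 iP; rewrite !bE ?fE // ltnS ltnW.
  move=> v w vX' wX' vw; have [vP|vP] := boolP (v \in P); first exact: key.
  have [wP|wP] := boolP (w \in P).
    have := key w v wP vX'; rewrite adj_sym => /(_ vw) /and4P[h1 h2 h3 h4].
    by apply/and4P; split; rewrite eq_sym.
  by rewrite !extX //; apply: col2; rewrite ?inX.
(* The middle vertex must be [a] or [c], and [u] its only neighbour in [P]. Then [w] is the opposite
   end or the one other neighbour in [X], and [extend_ear] avoided both colours. *)
- have key u v w : u \in P -> v \notin P -> v \in X -> w \in (X :|: [set v in P])%SET ->
      adj u v -> adj v w -> u != w -> ext b B u != ext b B w.
    move=> uP vP vX wX' uv vw uw.
    have vX' : v \in (X :|: [set v in P])%SET by rewrite inE vX.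
    have [i iP [Eu Ev]] := nbr' u v uP vX' uv.
    have v_ac : v = a \/ v = c.
      case: Ev => Ev.
        by case: i iP Ev {Eu} => [|i] iP Ev; [left|have := sP i (ltnW iP); rewrite -Ev (negbTE vP)].
      have [iP'|iP'] := ltnP i.+1 (size P); first by have := sP _ iP'; rewrite -Ev (negbTE vP).
      by right; rewrite Ev sS nth_default.
    case: v_ac => E; subst v.
      rewrite adj_sym in uv; have u1 := nbr_a _ uP uv.
      have wP : w \notin P by apply: contraNN uw => wP; rewrite u1 (nbr_a _ wP vw).
      rewrite u1 bE ?extX //; move: B1; rewrite !inE negb_or => /andP[B1 B1'].
      have [->//|wc] := eqVneq w c.
      by rewrite (Ha w) // inX.
    rewrite adj_sym in uv; have u1 := nbr_c _ uP uv.
    have wP : w \notin P by apply: contraNN uw => wP; rewrite u1 (nbr_c _ wP vw).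
    rewrite u1 bE ?extX //; move: Bl; rewrite !inE negb_or => /andP[Bl Bl'].
    have [->//|wa] := eqVneq w a.
    by rewrite (Hc w) // inX.
  move=> u v w uX' vX' wX' uv vw uw.
  have [vP|vP] := boolP (v \in P).
    (* For a middle vertex on the ear, [u] and [w] are its predecessor and successor there. *)
    have [/inP[i iP Ei]] := vP.
    have Hu : u = s i \/ u = s i.+2.
      by apply: nbr => //; [move: uX'; rewrite !inE|rewrite -sS -Ei adj_sym].
    have Hw : w = s i \/ w = s i.+2.
      by apply: nbr => //; [move: wX'; rewrite !inE|rewrite -sS -Ei].
    have ok := ok3 i iP.
    have [le1 le2] : i <= (size P).+1 /\ i.+2 <= (size P).+1 by rewrite !ltnS ltnW // ltnW.
    by case: Hu Hw uw => -> [] ->; rewrite ?eqxx // !bE // => _; rewrite eq_sym.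
  have vX := inX v vX' vP.
  have [uP|uP] := boolP (u \in P); first exact: (key u v w).
  have [wP|wP] := boolP (w \in P).
    by rewrite eq_sym; apply: (key w v u) => //; rewrite 1?adj_sym // eq_sym.
  by rewrite !extX //; apply: (col3 u v w) => //; apply: inX.
Qed.

End ColourExtension.

(** * Growing the cycle and its colouring *)

Section Cycle.
Variables (R : realType) (G : sgraph).
Hypothesis outer : outerplanar R G.
Implicit Types (X : {set G}) (a c u v w : G) (P : seq G).

Lemma rev_adj_path a P c :
  path (@adj G) a (rcons P c) -> path (@adj G) c (rcons (rev P) a).
Proof.
move=> p; rewrite -rev_cons -[a :: P](belast_rcons a P c) -{1}(last_rcons a P c).
by rewrite rev_path; apply: sub_path p => x y; rewrite adj_sym.
Qed.

Definition spanned_by_cycle X :=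
  exists s, [/\ ucycle (@adj G) s, X =i s & 1 < size s].

(* The two arcs of the cycle between the ends of an ear cannot both have
   inner vertices, since the ear would complete them to a theta. *)
Lemma ear_on_cycle X a P c : spanned_by_cycle X -> ear X a P c -> uniq P ->
  adj a c /\ spanned_by_cycle (X :|: [set v in P])%SET.
Proof.
move=> [s [us Xs s2]] eP uP.
have /and4P[/and3P[aX cX ac] P0 PX pP] := eP.
have := aX; rewrite Xs => /rot_to[i s' E].
have {us} us : ucycle (@adj G) (a :: s') by rewrite -E rot_ucycle.
have {}Xs : X =i a :: s' by move=> v; rewrite Xs -(mem_rot i) E.
have cs' : c \in s' by move: cX; rewrite Xs inE eq_sym (negbTE ac).
case/splitPr: cs' {E s2} us Xs => S1 S2 us Xs.
have /andP[/=] := us; rewrite rcons_cat cat_path /= => /and3P[p1 e1 p2].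
rewrite mem_cat inE !negb_or cat_uniq /= => /and5P[/and3P[aS1 _ aS2] uS1].
rewrite negb_or => /andP[cS1 S12] cS2 uS2.
have XP v : v \in P -> v \notin X by move=> vP; move/allP: PX => /(_ _ vP).
have pS1 : path (@adj G) a (rcons S1 c) by rewrite rcons_path p1.
have size2 T : 1 < size (a :: T ++ c :: S2) by rewrite /= size_cat /= addnS.
have arcs : S1 = [::] \/ S2 = [::].
  case: (eqVneq S1 [::]) => [|S10]; first by left.
  case: (eqVneq S2 [::]) => [|S20]; first by right.
  (* [S2] runs from [c] back to [a], so it is reversed to serve as a path from [a] to [c]. *)
  exfalso; pose T (i : 'I_3) := nth [::] [:: S1; rev S2; P] i.
  have SX v : v \in S1 ++ S2 -> v \in X.
    by rewrite Xs inE mem_cat inE mem_cat => /orP[]->; rewrite !orbT.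
  have dS v : v \in S1 -> v \in S2 -> False.
    by move=> v1 v2; move/hasPn: S12 => /(_ _ v2); rewrite /= v1.
  have dP v : v \in S1 ++ S2 -> v \in P -> False.
    by move=> /SX vX /XP; rewrite vX.
  apply: (@outerplanar_no_theta R G outer a c T) => //.
  - by case=> -[|[|[|//]]] i3; rewrite /T //= -size_eq0 size_rev size_eq0.
  - by case=> -[|[|[|//]]] i3; rewrite /T //=; apply: rev_adj_path.
  - case=> -[|[|[|//]]] i3; rewrite /T /= ?mem_rev ?aS1 ?aS2 //.
    by apply/andP; split; [apply: contraL aX|apply: contraL cX]; exact: XP.
  - case=> -[|[|[|//]]] i3; case=> -[|[|[|//]]] j3; rewrite /T //= => _; apply/hasPn => v /=;
    rewrite ?mem_rev => h1; apply/negP => h2.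
    + exact: dS h2 h1.
    + by apply: dP h1; rewrite mem_cat h2.
    + exact: dS h1 h2.
    + by apply: dP h1; rewrite mem_cat h2 orbT.
    + by apply: dP h2; rewrite mem_cat h1.
    + by apply: dP h2; rewrite mem_cat h1 orbT.
have uP' Q : Q =i P -> uniq Q -> uniq ((a :: S1 ++ c :: S2) ++ Q).
  move=> QP uQ; have /andP[_ u] := us; rewrite cat_uniq u uQ andbT /=.
  by apply/hasPn => v; rewrite QP => /XP; rewrite Xs.
(* The ear replaces the edge between [a] and [c] in the cycle, reversed when that edge is the
   closing one. *)
case: arcs => E; subst.
  split; first by move: pS1; rewrite /= andbT.
  exists (a :: P ++ c :: S2); split=> //; last first.
    move=> v; rewrite !(inE, mem_cat) Xs !(inE, mem_cat) /=.
    by case: (v == a); case: (v == c); case: (v \in S2); case: (v \in P).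
  apply/andP; split.
    by rewrite /= rcons_cat cat_path /=; move: pP; rewrite rcons_path => /andP[-> ->].
  rewrite (@perm_uniq _ _ ((a :: c :: S2) ++ P)); first exact: (uP' P).
  by rewrite /= perm_cons perm_catC.
split; first by move: p2; rewrite /= andbT adj_sym.
exists (a :: S1 ++ c :: rev P); split; last by rewrite /= size_cat /= addnS.
  apply/andP; split.
    by rewrite /= rcons_cat cat_path /= p1 e1; apply: rev_adj_path.
  have := uP' (rev P) (mem_rev P); rewrite rev_uniq => /(_ uP).
  by rewrite /= -catA.
move=> v; rewrite !(inE, mem_cat) Xs !(inE, mem_cat) mem_rev.
by case: (v == a); case: (v \in S1); case: (v == c); case: (v \in P).
Qed.

Hypothesis conn : k_connected G 2.
Hypothesis deg : max_degree G = 3.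
Hypothesis gir : least_ge (girth G) 4.

Lemma triangle_free a p c : adj a p -> adj p c -> adj c a -> False.
Proof.
move=> ap pc ca.
have tri : `[< exists s : seq G, is_cycle s /\ size s = 3 >].
  apply/asboolP; exists [:: a; p; c]; split=> //; split=> //.
  apply/andP; split; first by rewrite /= ap pc ca.
  rewrite /= !inE negb_or andbT -andbA; apply/and3P; split;
    by apply/eqP => E; subst; rewrite adj_irr in ap pc ca.
move: gir; rewrite /girth /least; case: pselect => [ex|[]]; last by exists 3.
by case: ex_minnP => n _ /(_ _ tri) n3 /= n4; have := leq_trans n4 n3.
Qed.

Lemma colouring_grow n X : #|~: X| <= n -> spanned_by_cycle X ->
  (exists b f, colouring X b f) ->
  exists b f, @colouring G [set: G]%SET b f.
Proof.
elim: n X => [|n IH] X nX cX [b [f col]].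
  suff <- : X = [set: G]%SET by exists b, f.
  apply/setP => v; move: nX; rewrite leqn0 cards_eq0 => /eqP/setP/(_ v).
  by rewrite !inE => /negbFE.
have [XT|XT] := eqVneq X [set: G]%SET; first by rewrite -XT; exists b, f.
have X2 : 1 < #|X|.
  have [s [/andP[_ us] Xs s2]] := cX.
  by rewrite (eq_card Xs) (card_uniqP us).
have [a [P [c sh]]] := shortest_ear_exists conn X2 XT.
have [ac cX'] := ear_on_cycle cX (proj1 sh) (shortest_ear_uniq sh).
have /and4P[/and3P[aX c_X anc] P0 PX pP] := proj1 sh.
(* A single inner vertex would form a triangle with the adjacent ends. *)
have P2 : 1 < size P.
  case: P P0 PX pP {sh cX'} => [|p [|q P]] //= _ _ /and3P[ap pc _].
  by case: (triangle_free ap pc); rewrite adj_sym.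
apply: (IH (X :|: [set v in P])%SET) => //; last exact: colour_ear deg sh P2 ac col.
rewrite -ltnS; apply: leq_trans nX; apply: proper_card.
case: P P0 PX {sh cX' pP P2} => // p P _ /andP[pX _].
apply/properP; split.
  by apply/fintype.subsetP => v; rewrite !inE negb_or => /andP[].
by exists p; rewrite !inE ?eqxx ?orbT.
Qed.

Lemma colouring_exists : exists b f, @colouring G [set: G]%SET b f.
Proof.
have [a [c ac]] : exists a c : G, adj a c.
  apply: contrapT => none; have : max_degree G <= 0; last by rewrite deg.
  apply/bigmax_leqP => v _; rewrite leqn0 cards_eq0; apply/eqP/setP => w.
  by rewrite !inE; apply/negP => vw; apply: none; exists v, w.
apply: (@colouring_grow #|~: [set a; c]%SET| [set a; c]%SET) => //.
  exists [:: a; c]; split=> //; last by move=> v; rewrite !inE.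
  apply/andP; split; first by rewrite /= ac adj_sym ac.
  by rewrite /= inE andbT; apply/eqP => E; rewrite E adj_irr in ac.
by have [b [f H]] := colour_edge a c; exists b, f; apply: H.
Qed.

End Cycle.

(** * From the two vertex functions to a colouring of vertices and incidences *)

Section Assembly.
Variable G : sgraph.
Implicit Types (i j : incidence G) (u v w : G) (x y : vi G).

Definition near_end i : G := (val i).1.
Definition far_end i : G :=
  odflt (near_end i) [pick w | adj (near_end i) w && ((val i).2 == [set near_end i; w])%SET].

Lemma far_endP i : adj (near_end i) (far_end i) /\
  (val i).2 = [set near_end i; far_end i]%SET.
Proof.
rewrite /far_end; case: pickP => /= [w /andP[iw /eqP]//|none].
have /andP[+ ie] := valP i; rewrite inE => /existsP[u /existsP[v /andP[uv /eqP e]]].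
have : near_end i \in [set u; v]%SET by rewrite -e.
rewrite !inE => /orP[] /eqP E.
  by have := none v; rewrite E uv e eqxx.
by have := none u; rewrite E adj_sym uv e finset.setUC eqxx.
Qed.

Lemma incidence_inj i j : near_end i = near_end j -> far_end i = far_end j -> i = j.
Proof.
move=> n o; apply: val_inj.
have [_ ei] := far_endP i; have [_ ej] := far_endP j.
by rewrite (surjective_pairing (val i)) (surjective_pairing (val j)) ei ej n o -/(near_end i) n.
Qed.

Lemma third_adjP x y : third_adj x y ->
  match x, y with
  | inl v, inr i | inr i, inl v => near_end i = v
  | inr i, inr j => near_end j = far_end i /\ far_end j = near_end i
  | inl _, inl _ => False
  end.
Proof.
case: x y => [v|i] [w|j] //= => [/eqP//|/eqP//|/andP[/eqP e n]].
have [_ ei] := far_endP i; have [_ ej] := far_endP j.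
have : near_end j \in (val i).2 by rewrite e ej !inE eqxx.
have : near_end i \in (val j).2 by rewrite -e ei !inE eqxx.
rewrite ei ej !inE -/(near_end i) -/(near_end j) [near_end j == near_end i]eq_sym.
by rewrite (negbTE n) /= => /eqP -> /eqP ->.
Qed.

Lemma third_dist3 x y : least_le (@graph_dist (one_third G) x y) 3 ->
  match x, y with
  | inl v, inl w => v = w \/ adj v w
  | inl v, inr i | inr i, inl v => near_end i = v \/ far_end i = v
  | inr i, inr j => near_end i = near_end j \/
                      far_end j = near_end i \/ far_end i = near_end j
  end.
Proof.
rewrite /graph_dist /least; case: pselect => //= ex.
case: ex_minnP => n /asboolP[p [pp <- <-]] _ {ex n}.
case: p pp => [|z1 [|z2 [|z3 [|]]]] //=.
- by move=> _ _; case: x => [v|i]; left.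
- by rewrite andbT => /third_adjP + _; case: x z1 => [v|i] [w|j] //; intuition.
- rewrite andbT => /andP[/third_adjP + /third_adjP] + _.
  by case: x z1 z2 => [v|i] [w|j] [w'|k] //; intuition congruence.
- rewrite andbT => /and3P[/third_adjP + /third_adjP + /third_adjP] + _.
  case: x z1 z2 z3 => [v|i] [w|j] [w'|k] [w''|l] //; try by intuition congruence.
  (* The walk along a whole subdivided edge, which joins adjacent vertices. *)
  by move=> <- [-> _] <-; right; case: (far_endP j).
Qed.

(** The members of [I2 v] are the incidences with far end [v], so colouring an incidence by [b] of
    its far end puts one colour on [I2 v]. *)
Lemma ks_colouring b f : colouring [set: G]%SET b f ->
  ks_coloring 1 (fun x => match x with inl v => f v | inr i => b (far_end i) end).
Proof.
move=> [col1 col2 col3].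
have cE v w : adj v w -> [&& b v != b w, f v != f w, f v != b w & b v != f w].
  by apply: col2; rewrite inE.
have cV v : f v != b v by apply: col1; rewrite inE.
split.
  move=> x y xy /third_dist3.
  have vi_col v j : near_end j = v \/ far_end j = v -> f v != b (far_end j).
    have [jj _] := far_endP j; case=> <- //.
    by have /and4P[] := cE _ _ jj.
  case: x y xy => [v|i] [w|j] xy /=.
  - case=> [E|/cE/and4P[//]]; by rewrite E eqxx in xy.
  - exact: vi_col.
  - by rewrite eq_sym; apply: vi_col.
  - have [ii _] := far_endP i; have [jj _] := far_endP j.
    case=> [E|[->|->]].
    (* Distinct incidences at one vertex have distinct far ends, and these are two steps apart
       through that vertex. *)
    + apply: (col3 _ (near_end i)); rewrite ?inE //; [by rewrite adj_sym|by rewrite E|].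
      by apply: contraNneq xy => E'; rewrite (incidence_inj E E').
    + by have /and4P[] := cE _ _ ii; rewrite eq_sym.
    + by have /and4P[] := cE _ _ jj.
move=> v; apply: leq_trans (_ : #|[set b v]%SET| <= 1); last by rewrite cards1.
apply: subset_leq_card.
apply/fintype.subsetP => k /imsetP[i]; rewrite !inE => /existsP[u /andP[vu /eqP E]] ->.
have [ii e] := far_endP i.
have nu : near_end i = u by rewrite /near_end E.
rewrite E nu /= in e; rewrite nu in ii.
have : far_end i \in [set u; v]%SET by rewrite e !inE eqxx orbT.
by rewrite !inE => /orP[] /eqP o; rewrite o ?adj_irr // in ii *.
Qed.

End Assembly.

Theorem theorem17 (R : realType) (G : sgraph)
  (Gconn : k_connected G 2)
  (Gouter : outerplanar R G)
  (Gdeg : max_degree G = 3)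
  (Ggirth : least_ge (girth G) 4) :
  least_le (chi_vi 1 G) 6.
Proof.
have [b [f /ks_colouring col]] := colouring_exists Gouter Gconn Gdeg Ggirth.
have col6 : `[< exists c : vi G -> 'I_6, ks_coloring 1 c >].
  by apply/asboolP; eexists; exact: col.
rewrite /chi_vi /least; case: pselect => [ex|[]]; last by exists 6.
by case: ex_minnP => n _ /(_ _ col6).
Qed.
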